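(* Let $b_n=\tfrac1n$ and let $f=2\chi_U-1$, where $U\subset S^1$ is a finite union of disjoint intervals with $m(U)=\tfrac12$. Then there are irrational numbers $\alpha\in(0,1)$ which are divergent for all points $x\in S^1$, that is, such that for every $x\in S^1$ the series $$\sum_{n=1}^\infty f(T^n x)\,b_n=\sum_{n=1}^\infty \frac{f(x+n\alpha)}{n}$$ diverges. Such an $\alpha$ can be provided explicitly in terms of its continued fraction expansion.
   Context: $S^1=\mathbb{R}/\mathbb{Z}$, $m$ is Lebesgue measure on $S^1$ (normalized so $m(S^1)=1$), and $\chi_U$ is the indicator function of $U$. For irrational $\alpha\in(0,1)$, $T=R_\alpha:S^1\to S^1$ is the rotation $Tx=x+\alpha$ (mod $1$). The number $\alpha$ is called divergent for a point $x$ and the function $f$ if the series $\sum_{n=1}^\infty f(T^n x)\,b_n$ diverges. The continued fraction expansion of $\alpha$ is written $\alpha=[a_1a_2a_3\ldots]$, with positive integer terms $a_n$. *)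

(* Defs.v *)
From mathcomp Require Import all_boot all_order all_algebra.
From mathcomp Require Import all_classical all_reals all_analysis.
From mathcomp Require Import generic_quotient ring_quotient.

Set Implicit Arguments.
Unset Strict Implicit.
Unset Printing Implicit Defensive.

Import Order.TTheory GRing.Theory Num.Theory.
Import numFieldNormedType.Exports.

Local Open Scope classical_set_scope.
Local Open Scope ring_scope.

(** * The circle *)

(** The additive subgroup [Num.int] of the integers of [R]. *)
Definition integers (R : realType) : zmodClosed R :=
  GRing.ZmodClosed.clone R (@Num.int_num_subdef R) _.

Definition circle (R : realType) : Type := Quotient.quot (integers R).

Definition to_circle (R : realType) (t : R) : circle R :=
  \pi_(Quotient.quot (integers R))%qT t.

(** The normalized Lebesgue measure: that of the lift to the fundamental
    domain [0, 1[. *)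
Definition circle_measure (R : realType) (A : set (circle R)) : \bar R :=
  lebesgue_measure ((`[0, 1[%classic : set R) `&` (@to_circle R @^-1` A)).

(** An interval of the circle is the projection of an interval of the line,
    of any kind (with or without its endpoints). *)
Definition is_arc (R : realType) (A : set (circle R)) : Prop :=
  exists I : interval R, A = @to_circle R @` [set` I].

Definition finite_disjoint_union_of_arcs (R : realType) (U : set (circle R))
    : Prop :=
  exists (k : nat) (A : 'I_k -> set (circle R)),
    [/\ forall i, is_arc (A i), trivIset setT A & U = \bigcup_i A i].

Definition rotation (R : realType) (alpha : R) (x : circle R) : circle R :=
  x + to_circle alpha.

Definition divergent_for (R : realType) (b : nat -> R) (f : circle R -> R)
    (alpha : R) (x : circle R) : Prop :=
  ~ cvgn (fun N : nat =>
      \sum_(1 <= n < N.+1) f (iter n (rotation alpha) x) * b n : R).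

(** * Continued fractions *)

(** [cfrac [:: a1; ..; an]] is 1/(a1 + 1/(a2 + .. + 1/an)). *)
Fixpoint cfrac (R : realType) (s : seq nat) : R :=
  if s is a :: s' then (a%:R + cfrac R s')^-1 else 0.

(** alpha = [a 1, a 2, a 3, ..], with positive integer terms; the value [a 0]
    is not used. *)
Definition has_cfrac_expansion (R : realType) (alpha : R) (a : nat -> nat)
    : Prop :=
  (forall n, (0 < a n.+1)%N) /\
  (fun n : nat => cfrac R (mkseq (fun i => a i.+1) n)) @ \oo --> alpha.

(** * Total recursive functions *)

(** Kleene's characterization of the total computable functions: the least
    class containing zero, successor and projections, closed under
    composition, primitive recursion on the first argument and minimization of
    functions that have a zero for all values of the parameters. *)
Inductive recursive : forall n : nat, (n.-tuple nat -> nat) -> Prop :=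
| recursive_zero : recursive (fun _ : 0.-tuple nat => 0%N)
| recursive_succ : recursive (fun v : 1.-tuple nat => (thead v).+1)
| recursive_proj n (i : 'I_n) : recursive (fun v : n.-tuple nat => tnth v i)
| recursive_comp m n (f : m.-tuple nat -> nat)
    (g : 'I_m -> n.-tuple nat -> nat) :
    recursive f -> (forall i, recursive (g i)) ->
    recursive (fun v => f [tuple g i v | i < m])
| recursive_prec n (f : n.-tuple nat -> nat) (g : n.+2.-tuple nat -> nat) :
    recursive f -> recursive g ->
    recursive (fun v : n.+1.-tuple nat =>
      nat_rect (fun=> nat) (f [tuple of behead v])
        (fun k r => g [tuple of k :: r :: behead v]) (thead v))
| recursive_mu n (f : n.+1.-tuple nat -> nat)
    (f0 : forall v : n.-tuple nat, exists k, f [tuple of k :: v] == 0%N) :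
    recursive f -> recursive (fun v : n.-tuple nat => ex_minn (f0 v)).

Definition computable (a : nat -> nat) : Prop :=
  recursive (fun v : 1.-tuple nat => a (thead v)).

(* Main.v *)
Require Import Defs.
From mathcomp Require Import all_boot all_order all_algebra.
From mathcomp Require Import all_classical all_reals all_analysis.
From mathcomp Require Import generic_quotient ring_quotient zify ring lra.

Set Implicit Arguments.
Unset Strict Implicit.
Unset Printing Implicit Defensive.

Import Order.TTheory GRing.Theory Num.Theory.
Import numFieldNormedType.Exports.

Local Open Scope classical_set_scope.
Local Open Scope ring_scope.

(** Let f = 2 * 1_U - 1. If p/q is close to alpha, then f(x + n alpha) is nearly
    q-periodic in n. If moreover q is odd, the sum of f over a full period is a
    sum of an odd number of signs, so it has absolute value at least 1, whatever
    x is. Over a block of times [M, 16^q M] on which the sequence is exactly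
    q-periodic, the weights 1/n turn this into a contribution of size about
    (1/q) * log (16^q), which is at least 1 ([periodic_sign_block]).

    Exact periodicity can fail only at a time n for which an endpoint of an arc
    of U lies between x + n alpha and x + (n + q) alpha. The second point is the
    first one displaced by eta = q alpha - p, and if eta is small enough compared
    to the time horizon N, the successive displaced segments do not return to
    where they have been: each endpoint is responsible for failures in at most
    one of several disjoint blocks below N. With more consecutive blocks than
    endpoints, some block is free of failures ([exists_uncrossed_block]). Such
    blocks exist arbitrarily far for every x, as soon as alpha has odd
    denominators q with |q alpha - p| doubly exponentially small in q, so the
    Cauchy criterion fails ([divergent_of_approx]).

    The required alpha is the one with partial quotients a_1 = 2 and
    a_(n+1) = 2^(2^(a_n)). All of them are even, so every other denominator of a
    convergent is odd; they grow so fast that the denominator q_n is below a_n^2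
    while a_(n+1), which controls the quality of the n-th convergent, exceeds
    everything needed ([tower_dominates]). The same alpha serves all U, and the
    sequence is primitive recursive ([computable_tower]). *)

(** * Harmonic sums of periodic signs *)

Lemma harmonic_dyadic (R : realType) m j : (0 < m)%N ->
  j%:R / 2 <= \sum_(m <= l < m * 2 ^ j) l%:R^-1 :> R.
Proof.
move=> m0; elim: j => [|j ih]; first by rewrite mul0r expn0 muln1 big_geq.
set k := (m * 2 ^ j)%N in ih *; have k0 : (0 < k)%N by rewrite muln_gt0 m0 expn_gt0.
have mk : (m <= k)%N by rewrite leq_pmulr// expn_gt0.
have -> : (m * 2 ^ j.+1 = k + k)%N by rewrite expnS mulnCA mul2n addnn.
rewrite (@big_cat_nat _ _ _ k)//= ?leq_addr// -natr1 mulrDl lerD//.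
apply: le_trans (_ : \sum_(k <= l < k + k) (k + k)%:R^-1 <= _).
  rewrite sumr_const_nat addKn natrD -[leRHS]mulr_natl.
  have kR : k%:R != 0 :> R by rewrite pnatr_eq0 -lt0n.
  by rewrite -mulr2n -[(k%:R *+ 2)]mulr_natl invfM mulrCA divff// mulr1 div1r.
apply: ler_sum_nat => l /andP[kl lk].
by rewrite lef_pV2 ?posrE ?ltr0n ?addn_gt0 ?k0 ?(leq_trans k0 kl)// ler_nat ltnW.
Qed.

(** Replacing the weights 1/(m+i) by 1/m costs at most q/m^2 for each of the q
    terms, and q^2/m^2 is at most half of the main term 1/m. *)
Lemma harmonic_period_ge (R : realType) (q m : nat) (c : nat -> R) :
  (0 < q)%N -> (2 * q ^ 2 <= m)%N -> (forall i, `|c i| <= 1) ->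
  1 <= \sum_(i < q) c i ->
  (2 * m%:R)^-1 <= \sum_(i < q) c i / (m + i)%:R.
Proof.
move=> q0 qm c1 S1; have m0 : (0 < m)%N by nia.
have m0R : 0 < m%:R :> R by rewrite ltr0n.
apply: le_trans (_ : \sum_(i < q) (c i / m%:R - q%:R / m%:R ^+ 2) <= _).
  rewrite sumrB -mulr_suml sumr_const card_ord -[_ *+ q]mulr_natl.
  apply: le_trans (_ : m%:R^-1 - q%:R * (q%:R / m%:R ^+ 2) <= _).
    rewrite -subr_ge0; have -> : m%:R^-1 - q%:R * (q%:R / m%:R ^+ 2)
      - (2 * m%:R)^-1 = (m%:R - 2 * q%:R ^+ 2) / (2 * m%:R ^+ 2) :> R.
      by field; rewrite gt_eqF.
    by rewrite divr_ge0// subr_ge0 -natrX -natrM ler_nat.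
  by rewrite lerD2r ler_peMl ?invr_ge0 ?(ltW m0R).
apply: ler_sum => i _; rewrite lerBlDr -lerBlDl -mulrBr.
have mi0 : 0 < (m + i)%:R :> R by rewrite ltr0n addn_gt0 m0.
have -> : m%:R^-1 - (m + i)%:R^-1 = i%:R / (m%:R * (m + i)%:R) :> R.
  by rewrite natrD; field; rewrite -natrD !gt_eqF.
apply: le_trans (ler_norm _) _; rewrite normrM.
rewrite [X in _ * X]ger0_norm ?divr_ge0//.
apply: le_trans (ler_piMl _ (c1 i)) _; first by rewrite divr_ge0.
rewrite ler_pM ?invr_ge0// ?ler_nat 1?ltnW//.
by rewrite lef_pV2 ?posrE ?mulr_gt0// expr2 ler_wpM2l// ler_nat leq_addr.
Qed.

(** The block is cut into the periods [l * q, (l + 1) * q); the one starting at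
    l * q contributes at least 1/(2 l q). *)
Lemma periodic_harmonic_ge (R : realType) (q m L : nat) (c : nat -> R) :
  (0 < q)%N -> (2 * q <= m)%N -> (forall i, `|c i| <= 1) ->
  1 <= \sum_(i < q) c (m * q + i)%N ->
  (forall n, (m * q <= n)%N -> (n + q < (m + L) * q)%N -> c (n + q)%N = c n) ->
  (2 * q%:R)^-1 * \sum_(m <= l < m + L) l%:R^-1 <=
  \sum_(m * q <= n < (m + L) * q) c n / n%:R.
Proof.
move=> q0 qm c1 S1.
elim: L => [|L ih] per; first by rewrite addn0 !big_geq// mulr0.
have {}ih := ih (fun n h1 h2 => per n h1 (leq_trans h2 (leq_mul
  (leq_add (leqnn m) (leqnSn L)) (leqnn q)))).
have shift l i : (l <= L)%N -> (i < q)%N -> c ((m + l) * q + i)%N = c (m * q + i)%N.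
  elim: l => [|l ihl] lL iq; first by rewrite addn0.
  rewrite -ihl//; last exact: ltnW.
  have -> : ((m + l.+1) * q + i = (m + l) * q + i + q)%N by lia.
  by apply: per; nia.
rewrite addnS big_nat_recr ?leq_addr//= mulrDr.
rewrite [leRHS](@big_cat_nat _ _ _ ((m + L) * q))/= ?leq_mul ?leq_addr//.
apply: lerD; first exact: ih.
rewrite -{1}[((m + L) * q)%N]add0n big_addn mulSn addnK big_mkord.
rewrite -invfM -mulrA -natrM [(q * _)%N]mulnC.
apply: le_trans (harmonic_period_ge (c := fun i => c ((m + L) * q + i)%N) q0 _ _ _) _.
- by nia.
- by [].
- rewrite (eq_bigr (fun i : 'I_q => c (m * q + i)%N))// => i _.
  exact: shift.
- by under [leRHS]eq_bigr do rewrite addnC.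
Qed.

(** An odd number of signs cannot cancel. The statement separates the two
    possible signs of the sum by flipping all the terms in the second case, so
    that only positive sums need to be treated afterwards. *)
Lemma odd_sign_sum (R : realType) (q : nat) (b : nat -> bool) : odd q ->
  (1 <= \sum_(i < q) (2 * (b i)%:R - 1) :> R) \/
  (1 <= \sum_(i < q) (2 * (~~ b i)%:R - 1) :> R).
Proof.
move=> oq; set B := (\sum_(i < q) b i)%N.
have SB : \sum_(i < q) (2 * (b i)%:R - 1) = (2 * B)%:R - q%:R :> R.
  by rewrite sumrB -mulr_sumr natrM /B natr_sum sumr_const card_ord.
have -> : \sum_(i < q) (2 * (~~ b i)%:R - 1) = q%:R - (2 * B)%:R :> R.
  rewrite -opprB -SB -sumrN.
  by apply: eq_bigr => i _; case: (b i) => /=; lra.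
rewrite SB {SB}; case: (ltngtP (2 * B) q) => h.
- by right; move: h; rewrite -(ler_nat R) -natr1; lra.
- by left; move: h; rewrite -(ler_nat R) -natr1; lra.
- by move: oq; rewrite -h mul2n odd_double.
Qed.

(** The length ratio 16^q = 2^(4q) makes the harmonic sum over the periods at
    least 2q, which compensates the factor 1/(2q) lost by keeping a single unit
    per period. *)
Lemma periodic_sign_block (R : realType) (q m : nat) (b : nat -> bool) :
  odd q -> (2 * q <= m)%N ->
  (forall n, (m * q <= n)%N -> (n + q < m * 16 ^ q * q)%N -> b (n + q)%N = b n) ->
  1 <= `|\sum_(m * q <= n < m * 16 ^ q * q) (2 * (b n)%:R - 1) / n%:R : R|.
Proof.
move=> oq qm per; have q0 : (0 < q)%N by case: (q) oq.
have m0 : (0 < m)%N by lia.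
pose L := (m * 16 ^ q - m)%N.
have mL : (m * 16 ^ q = m + L)%N by rewrite /L subnKC// leq_pmulr// expn_gt0.
suff key (c : nat -> bool) :
    (forall n, (m * q <= n)%N -> (n + q < m * 16 ^ q * q)%N -> c (n + q)%N = c n) ->
    1 <= \sum_(i < q) (2 * (c (m * q + i)%N)%:R - 1) :> R ->
    1 <= \sum_(m * q <= n < m * 16 ^ q * q) (2 * (c n)%:R - 1) / n%:R :> R.
  have [S1|S1] := odd_sign_sum R (fun i => b (m * q + i)%N) oq.
    by apply: le_trans (ler_norm _); exact: key.
  rewrite -normrN -sumrN; apply: le_trans (ler_norm _).
  have := key (fun n => ~~ b n) _ S1.
  rewrite (eq_bigr (fun n => - ((2 * (b n)%:R - 1) / n%:R))); last first.
    by move=> n _; rewrite -mulNr; congr (_ / _); case: (b n) => /=; lra.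
  by apply => n h1 h2; rewrite per.
move=> perc S1; rewrite mL.
apply: le_trans (periodic_harmonic_ge (c := fun n => 2 * (c n)%:R - 1) q0 qm _ S1 _).
- have := harmonic_dyadic R (4 * q) m0; rewrite expnM -[(2 ^ 4)%N]/16%N mL => h.
  have q0R : 0 < 2 * q%:R :> R by rewrite mulr_gt0 ?ltr0n.
  by rewrite mulrC ler_pdivlMr// mul1r; apply: le_trans h; rewrite natrM; lra.
- by move=> i; case: (c i) => /=; rewrite ler_norml; lra.
- by move=> n h1 h2; rewrite perc// mL.
Qed.

(** * Crossing the boundary of a union of arcs *)

Lemma to_circleD (R : realType) (s t : R) :
  to_circle (s + t) = to_circle s + to_circle t.
Proof. by rewrite /to_circle [LHS]raddfD. Qed.

Lemma to_circle_eq (R : realType) (s t : R) :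
  to_circle s = to_circle t <-> exists z : int, s + z%:~R = t.
Proof.
split=> [/eqP|[z <-]].
  rewrite /to_circle -Quotient.idealrBE => /intrP[z zE].
  by exists (- z); rewrite rmorphN/=; lra.
apply/eqP; rewrite /to_circle -Quotient.idealrBE opprD addrA subrr sub0r.
by apply/intrP; exists (- z); rewrite rmorphN.
Qed.

Lemma to_circle_surj (R : realType) (x : circle R) : exists t, x = to_circle t.
Proof. by exists (repr x); rewrite /to_circle reprK. Qed.

Lemma iter_rotation (R : realType) (alpha t : R) n :
  iter n (rotation alpha) (to_circle t) = to_circle (t + n%:R * alpha).
Proof.
elim: n => [|n ih]; first by rewrite mul0r addr0.
by rewrite iterS ih /rotation -to_circleD -natr1 mulrDl mul1r addrA.
Qed.

(** The only information on a union of arcs that the argument uses: its indicator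
    function, lifted to the line, is locally constant away from the translates
    of finitely many points. *)
Definition crossed_at (R : realType) (A : set (circle R)) (E : seq R) :=
  forall s t : R, s <= t -> (to_circle s \in A) != (to_circle t \in A) ->
  exists x (z : int), x \in E /\ s <= x + z%:~R <= t.

Definition bound_point (R : realType) (b : itv_bound R) : seq R :=
  if b is BSide _ x then [:: x] else [::].

Lemma interval_crossing (R : realType) (l r : itv_bound R) (s t : R) : s <= t ->
  (s \in Interval l r) != (t \in Interval l r) ->
  exists2 x, x \in bound_point l ++ bound_point r & s <= x <= t.
Proof.
move=> st; rewrite !itv_boundlr.
(* Membership at one of s, t only means that one of the two bounds separates
   them; the impossible combinations contradict s <= t. *)
have [sl|sl] := boolP (l <= BLeft s)%O; have [tl|tl] := boolP (l <= BLeft t)%O;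
have [sr|sr] := boolP (BRight s <= r)%O; have [tr|tr] := boolP (BRight t <= r)%O => //= _.
all: try by case/negP: tl; apply: le_trans sl _; rewrite bnd_simp.
all: try by case/negP: sr; apply: le_trans _ tr; rewrite bnd_simp.
all: move: sl tl sr tr; case: l => [[] x|[]]; case: r => [[] y|[]];
  rewrite ?bnd_simp //= => *.
all: try (exists x; [by rewrite !inE eqxx ?orbT|lra]).
all: try (exists y; [by rewrite !inE eqxx ?orbT|lra]).
Qed.

Lemma crossed_at_arc (R : realType) (A : set (circle R)) :
  is_arc A -> exists E, crossed_at A E.
Proof.
case=> -[l r] ->; set I := Interval l r.
exists (bound_point l ++ bound_point r) => s t st.
have memP (u : R) : (to_circle u \in @to_circle R @` [set` I]) <->
    exists z : int, u + z%:~R \in I.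
  rewrite inE/=; split=> [[v vI /esym/to_circle_eq[z zu]]|[z zI]].
    by exists z; rewrite zu.
  by exists (u + z%:~R) => //; apply/esym/to_circle_eq; exists z.
move=> hst; have [z zst] : exists z : int, (s + z%:~R \in I) != (t + z%:~R \in I).
  move: hst => /eqP hst; apply/not_existsP => heq; apply: hst.
  have {}heq (z : int) : (s + z%:~R \in I) = (t + z%:~R \in I).
    by apply/eqP; apply: contra_notT (heq z).
  by apply/idP/idP => /memP[z zI]; apply/memP; exists z; [rewrite -heq|rewrite heq].
have [|x xE xz] := interval_crossing _ zst; first by rewrite lerD2r.
by exists x, (- z); split=> //; rewrite rmorphN/=; lra.
Qed.

Lemma crossed_at_union (R : realType) (U : set (circle R)) :
  finite_disjoint_union_of_arcs U -> exists E, crossed_at U E.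
Proof.
case=> k [A [arcA _ ->]].
have /choice[E hE] i := crossed_at_arc (arcA i).
exists (flatten [seq E i | i <- enum 'I_k]) => s t st hst.
have [i hi] : exists i, (to_circle s \in A i) != (to_circle t \in A i).
  apply/not_existsP => h; move/eqP: hst; apply.
  have {}h i : (to_circle s \in A i) = (to_circle t \in A i).
    by apply/eqP; apply: contra_notT (h i).
  by apply/idP/idP; rewrite !inE => -[i _ /mem_set Ai]; exists i => //;
    apply: set_mem; [rewrite -h|rewrite h].
have [x [z [xE xz]]] := hE i s t st hi.
exists x, z; split=> //; apply/flattenP; exists (E i) => //.
by apply: map_f; rewrite mem_enum.
Qed.

Lemma intr_norm_gap (R : realDomainType) (m : int) :
  ~~ (0 < `|m%:~R : R| < 1).
Proof. by rewrite -intr_norm -[1]/(1%:~R) -[0]/(0%:~R) !ltr_int; lia. Qed.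

Lemma dist_le_between (R : realDomainType) (e d d' : R) :
  (0 <= d <= e) || (e <= d <= 0) -> (0 <= d' <= e) || (e <= d' <= 0) ->
  `|d' - d| <= `|e|.
Proof.
have [e0|e0] := ger0P e; rewrite ler_norml;
  by case/orP=> /andP[? ?] /orP[] /andP[? ?]; apply/andP; split; lra.
Qed.

(** Suppose that each of the K blocks contains a failure n of q-periodicity. Then
    a translate x + z of a point of E lies between t + n alpha and
    t + n alpha + eta, where eta = q alpha - p. Having more blocks than points,
    two failures n < n' share the same x. Subtracting the two localizations and
    multiplying by q exhibits the integer q (z' - z) - p (n' - n) as
    eta (n' - n) up to an error at most q |eta|. Since n' - n exceeds q, this
    integer is nonzero, and since n' - n + q is at most B K + q its absolute
    value is below 1. *)
Lemma exists_uncrossed_block (R : realType) (A : set (circle R)) (E : seq R)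
    (alpha t : R) (q K : nat) (p : int) (B : nat -> nat) :
  crossed_at A E -> (size E < K)%N -> {homo B : i j / (i <= j)%N} ->
  0 < `|q%:R * alpha - p%:~R| ->
  `|q%:R * alpha - p%:~R| * (B K + q)%:R < 1 ->
  exists2 i, (i < K)%N & forall n, (B i <= n)%N -> (n + q < B i.+1)%N ->
    (to_circle (t + (n + q)%:R * alpha) \in A) =
    (to_circle (t + n%:R * alpha) \in A).
Proof.
set eta := q%:R * alpha - p%:~R => hE sK mB eta0 etaN.
apply: contrapT => /forall2NP hbad.
have /choice[f hf] (i : 'I_K) : exists f : nat * R * int,
    let: (n, x, z) := f in let d := x + z%:~R - (t + n%:R * alpha) in
    [/\ (B i <= n)%N, (n + q < B i.+1)%N, x \in E &
        (0 <= d <= eta) || (eta <= d <= 0)].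
  case: (hbad i) => [|/existsNP[n]]; first by case; exact: ltn_ord.
  move=> /not_implyP[Bn] /not_implyP[nB] /eqP neq.
  have ptE : to_circle (t + (n + q)%:R * alpha) =
             to_circle (t + n%:R * alpha + eta).
    apply/to_circle_eq; exists (- p).
    by rewrite rmorphN/= /eta natrD mulrDl !addrA.
  have [eta_ge0|eta_lt0] := leP 0 eta.
    have [||x [z [xE /andP[xz1 xz2]]]] := hE (t + n%:R * alpha) (t + n%:R * alpha + eta).
    - by rewrite lerDl.
    - by rewrite -ptE eq_sym.
    exists (n, x, z); split=> //; apply/orP; left; lra.
  have [||x [z [xE /andP[xz1 xz2]]]] := hE (t + n%:R * alpha + eta) (t + n%:R * alpha).
  - by rewrite gerDl ltW.
  - by rewrite -ptE.
  by exists (n, x, z); split=> //; apply/orP; right; lra.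
have /injectivePn[i [j]] : ~~ injectiveb (fun i => (f i).1.2).
  apply/negP => uf; have : (K <= size E)%N.
    rewrite -[K]card_ord -(size_codom (fun i => (f i).1.2)).
    apply: uniq_leq_size => // x /codomP[i ->].
    by move: (hf i); case: (f i) => [[n y] z] [].
  by rewrite leqNgt sK.
wlog ij : i j / (i < j)%N.
  move=> hw; rewrite neq_ltn => /orP[ij|ji] h.
    by apply: (hw i j) => //; rewrite neq_ltn ij.
  by apply: (hw j i ji) => //; rewrite neq_ltn ji.
move=> _; move: (hf i) (hf j); case: (f i) (f j) => [[n x] z] [[n' x'] z'].
move=> [_ nB _ hd] [Bn' n'B _ hd'] /= xE; rewrite -{}xE in hd'.
have nqn' : (n + q < n')%N.
  by apply: leq_trans nB (leq_trans _ Bn'); exact: mB.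
have n'BK : (n' <= B K)%N.
  apply: leq_trans (leq_addr q _) _; apply: ltnW (leq_trans n'B _).
  by apply: mB; exact: ltn_ord.
have dn1 : q%:R < n'%:R - n%:R :> R by rewrite ltrBrDl -natrD ltr_nat.
have dn2 : n'%:R - n%:R + q%:R <= (B K + q)%:R :> R.
  by rewrite natrD lerD2r lerBlDr -natrD ler_nat (leq_trans n'BK)// leq_addr.
have I1 : (q%:Z * (z' - z) - p * (n'%:Z - n%:Z))%:~R = eta * (n'%:R - n%:R) +
  q%:R * ((x + z'%:~R - (t + n'%:R * alpha)) - (x + z%:~R - (t + n%:R * alpha))).
  rewrite rmorphB !rmorphM !rmorphB/= -!pmulrn /eta. ring.
have q0 : 0 <= q%:R :> R by [].
move: (B K + q)%:R etaN dn2 I1 => N etaN dn2.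
set m := (q%:Z * _ - _); move: hd hd'.
set d := (x + z%:~R - _); set d' := (x + z'%:~R - _) => hd hd' I1.
have dd : `|d' - d| <= `|eta| by exact: dist_le_between.
have Dn0 : 0 <= n'%:R - n%:R :> R by lra.
have qd : `|q%:R * (d' - d)| <= `|eta| * q%:R.
  by rewrite normrM ger0_norm// mulrC ler_wpM2r.
suff : 0 < `|m%:~R : R| < 1 by exact/negP/intr_norm_gap.
  rewrite I1; apply/andP; split.
    apply: lt_le_trans (lerB_normD _ _); rewrite subr_gt0.
    by apply: le_lt_trans qd _; rewrite normrM (ger0_norm Dn0) ltr_pM2l.
  apply: le_lt_trans (ler_normD _ _) _; apply: le_lt_trans (lerD (lexx _) qd) _.
  rewrite normrM (ger0_norm Dn0) -mulrDr.
  by apply: le_lt_trans etaN; rewrite ler_wpM2l.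
Qed.

(** The K blocks are [2 q^2 16^(q i), 2 q^2 16^(q (i + 1))), so the last one ends
    at the time 2 q^2 16^(q K) of the hypothesis; K is taken larger than the
    number of boundary points. *)
Lemma divergent_of_approx (R : realType) (U : set (circle R)) (E : seq R)
    (alpha : R) (x : circle R) :
  crossed_at U E -> irrational alpha ->
  (forall K n0, exists (q : nat) (p : int), [/\ odd q, (n0 <= q)%N &
    `|q%:R * alpha - p%:~R| * (2 * q ^ 2 * 16 ^ (q * K) + q)%:R < 1]) ->
  divergent_for (fun n : nat => n%:R^-1 : R)
    (fun y : circle R => 2 * \1_U y - 1) alpha x.
Proof.
move=> hE irr happ; have [t ->] := to_circle_surj x.
rewrite /divergent_for; set S := (fun N : nat => _) => cS.
have /cvgrPdist_lt/(_ 2^-1)[|n0 _ hn0] := cS; first by rewrite invr_gt0.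
have [q [p [oq n0q hq]]] := happ (size E).+1 n0.+1.
have q0 : (0 < q)%N by case: (q) oq.
pose m i := (2 * q * 16 ^ (q * i))%N.
have mS i : (m i.+1 = m i * 16 ^ q)%N by rewrite /m mulnS expnD; ring.
have m_ge i : (2 * q <= m i)%N by rewrite leq_pmulr// expn_gt0.
have [|||i iK per] := @exists_uncrossed_block R U E alpha t q (size E).+1 p
    (fun i => m i * q)%N hE (ltnSn _).
- apply: homo_leq => [//|y u v|i]; first exact: leq_trans.
  by rewrite mS leq_mul// leq_pmulr// expn_gt0.
- rewrite normr_gt0 subr_eq0; apply/eqP => qa; apply: irr.
  apply/rationalP; exists p, q; rewrite -qa mulrC mulKf// pnatr_eq0 -lt0n//.
- move: hq; rewrite /m; set e := (16 ^ _)%N.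
  by rewrite (_ : 2 * q ^ 2 * e = 2 * q * e * q)%N//; ring.
have := periodic_sign_block R (b := fun n => to_circle (t + n%:R * alpha) \in U)
  oq (m_ge i) _; rewrite -mS => /(_ per).
have SE u v : (0 < u)%N -> (u <= v)%N ->
    \sum_(u <= n < v) (2 * (to_circle (t + n%:R * alpha) \in U)%:R - 1) / n%:R =
    S v.-1 - S u.-1 :> R.
  move=> u0 uv; rewrite /S !prednK ?(leq_trans u0)//.
  rewrite [X in X - _](@big_cat_nat _ _ _ u)//= addrAC subrr add0r.
  by apply: eq_bigr => n _; rewrite iter_rotation indicE.
have big k : (n0 <= (m k * q).-1)%N by have := m_ge k; nia.
have mi0 : (0 < m i * q)%N by have := m_ge i; nia.
rewrite SE//; last by rewrite mS leq_mul// leq_pmulr// expn_gt0.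
have := hn0 _ (big i); have := hn0 _ (big i.+1); rewrite /= !ltr_norml.
move=> /andP[? ?] /andP[? ?]; rewrite leNgt ltr_norml; lra.
Qed.

(** * Continued fractions *)

(** The common recurrence w_n = a_n w_(n-1) + w_(n-2) of the numerators and
    denominators of convergents, carrying the pair (w_n, w_(n-1)). The initial
    pair (u, v) is (w_0, w_(-1)). *)
Fixpoint continuants (a : nat -> nat) (u v n : nat) : nat * nat :=
  if n is m.+1 then
    let w := continuants a u v m in (a n * w.1 + w.2, w.1)%N
  else (u, v).

Definition cnum a n := (continuants a 0 1 n).1.
Definition cden a n := (continuants a 1 0 n).1.
Definition cnum_prev a n := (continuants a 0 1 n).2.
Definition cden_prev a n := (continuants a 1 0 n).2.

(** [cfrac_tail [:: a1; ..; an] x] is 1/(a1 + 1/(a2 + .. + 1/(an + x))): the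
    continued fraction with its tail replaced by a free variable, which makes
    extension at the far end tractable. *)
Definition cfrac_tail (R : realType) (s : seq nat) (x : R) : R :=
  foldr (fun a r => (a%:R + r)^-1) x s.

Lemma cfrac_tail0 (R : realType) s : cfrac_tail s 0 = cfrac R s.
Proof. by elim: s => //= a s ->. Qed.

Lemma cfrac_tail_ge0 (R : realType) s (x : R) : 0 <= x -> 0 <= cfrac_tail s x.
Proof. by move=> x0; elim: s => //= a s ih; rewrite invr_ge0 addr_ge0. Qed.

Lemma cden_gt0 a n : (forall i, 0 < a i.+1)%N -> (0 < cden a n)%N.
Proof.
move=> a0; rewrite /cden; elim: n => //= n ih.
by rewrite addn_gt0 muln_gt0 a0 ih.
Qed.

Lemma cfrac_tail_convergent (R : realType) a n (x : R) :
  (forall i, 0 < a i.+1)%N -> 0 <= x ->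
  cfrac_tail (mkseq (fun i => a i.+1) n) x =
  ((cnum a n)%:R + x * (cnum_prev a n)%:R) /
  ((cden a n)%:R + x * (cden_prev a n)%:R).
Proof.
move=> a0; elim: n x => [|n ih] x x0.
  by rewrite /cnum /cnum_prev /cden /cden_prev /= mulr0 addr0 divr1 add0r mulr1.
have ax0 : 0 < (a n.+1)%:R + x by rewrite ltr_pwDl// ltr0n.
rewrite mkseqS /cfrac_tail foldr_rcons -/(cfrac_tail _ _) ih ?invr_ge0 ?ltW//.
have q0 : 0 < (cden a n)%:R :> R by rewrite ltr0n cden_gt0.
have q'0 : 0 <= (cden_prev a n)%:R :> R by [].
rewrite /cnum /cnum_prev /cden /cden_prev /= -!/(cnum _ _) -!/(cden _ _).
rewrite -!/(cnum_prev _ _) -!/(cden_prev _ _) !natrD !natrM.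
move: (cnum a n)%:R (cnum_prev a n)%:R (cden a n)%:R (cden_prev a n)%:R
  (a n.+1)%:R ax0 q0 q'0 => p p' q q' A ax0 q0 q'0.
have d0 : 0 < A * q + q' + x * q.
  by rewrite addrAC -mulrDl ltr_pwDl// mulr_gt0.
by field; rewrite !gt_eqF.
Qed.

Lemma continuant_det (R : realType) a n :
  (cnum_prev a n)%:R * (cden a n)%:R - (cnum a n)%:R * (cden_prev a n)%:R
  = (-1) ^+ n :> R.
Proof.
rewrite /cnum /cnum_prev /cden /cden_prev.
elim: n => [|n ih]; first by rewrite /= expr0; ring.
by rewrite exprS -ih /= !natrD !natrM; ring.
Qed.

(** Every later convergent is [cfrac_tail] of the first n terms at some tail x
    between 0 and 1/a_(n+1), and its distance to p_n/q_n is then given by the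
    determinant identity. Stating the bound between convergents gives both the
    existence of the limit and the quality of its approximation. *)
Lemma cfrac_approx (R : realType) a n m :
  (forall i, 0 < a i.+1)%N -> (n <= m)%N ->
  `|(cden a n)%:R * cfrac R (mkseq (fun i => a i.+1) m) - (cnum a n)%:R|
  <= ((a n.+1)%:R * (cden a n)%:R)^-1.
Proof.
move=> a0 nm.
have q0 : 0 < (cden a n)%:R :> R by rewrite ltr0n cden_gt0.
have q'0 : 0 <= (cden_prev a n)%:R :> R by [].
have A0 : 0 < (a n.+1)%:R :> R by rewrite ltr0n.
have [x /andP[x0 xa] ->] : exists2 x : R, 0 <= x <= (a n.+1)%:R^-1 &
    cfrac R (mkseq (fun i => a i.+1) m) =
    cfrac_tail (mkseq (fun i => a i.+1) n) x.
  rewrite -(subnKC nm) /mkseq iotaD map_cat add0n.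
  case: (m - n)%N => [|k] /=.
    by exists 0; [rewrite lexx invr_ge0 ltW|rewrite cfrac_tail0 cats0].
  set s := map _ (iota n.+1 k).
  exists (cfrac_tail (a n.+1 :: s) 0); last first.
    by rewrite -cfrac_tail0 /cfrac_tail foldr_cat.
  rewrite cfrac_tail_ge0//= lef_pV2 ?posrE//.
    by rewrite lerDl; exact: cfrac_tail_ge0.
  by rewrite ltr_pwDl//; exact: cfrac_tail_ge0.
rewrite cfrac_tail_convergent//.
have d0 : 0 < (cden a n)%:R + x * (cden_prev a n)%:R.
  by rewrite ltr_pwDl// mulr_ge0.
have -> : (cden a n)%:R * (((cnum a n)%:R + x * (cnum_prev a n)%:R) /
    ((cden a n)%:R + x * (cden_prev a n)%:R)) - (cnum a n)%:R =
    x / ((cden a n)%:R + x * (cden_prev a n)%:R) * (-1) ^+ n :> R.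
  rewrite -(continuant_det R a n); field; exact: lt0r_neq0.
rewrite normrM normrX normrN1 expr1n mulr1 ger0_norm ?divr_ge0 ?(ltW d0)//.
rewrite invfM ler_pM ?invr_ge0 ?(ltW d0)// lef_pV2 ?posrE//.
by rewrite lerDl mulr_ge0.
Qed.

Lemma cden_ge a n : (forall i, 0 < a i.+1)%N -> (1 < a 1)%N -> (n < cden a n)%N.
Proof.
move=> a0 a1.
suff : (n < cden a n)%N /\ ((0 < n)%N -> (0 < cden_prev a n)%N) by case.
rewrite /cden /cden_prev; elim: n => // n [ih1 ih2] /=; split => [|_]; last first.
  exact: leq_ltn_trans ih1.
case: n ih1 ih2 => [|n] ih1 ih2; first by move: a1 => /=; lia.
have := ih2 isT; have := a0 n.+1.
set w := (continuants a 1 0 n.+1) in ih1 *; move: w.1 w.2 ih1 => u v.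
by move: (a n.+2) => A; nia.
Qed.

Lemma cfrac_limit (R : realType) a :
  (forall i, 0 < a i.+1)%N -> (1 < a 1)%N ->
  exists2 alpha : R, has_cfrac_expansion alpha a &
  forall n, `|(cden a n)%:R * alpha - (cnum a n)%:R|
            <= ((a n.+1)%:R * (cden a n)%:R)^-1.
Proof.
move=> a0 a1; set c := fun n => cfrac R (mkseq (fun i => a i.+1) n).
have q0 n : 0 < (cden a n)%:R :> R by rewrite ltr0n cden_gt0.
have cc : cvgn c.
  apply/cauchy_cvgP/cauchy_exP => e e0.
  have [n ne] : exists n, (n.+1)%:R^-1 < e.
    by have [n _ /(_ n (leqnn n))] := near_infty_natSinv_lt (PosNum e0); exists n.
  exists ((cnum a n)%:R / (cden a n)%:R) => /=.
  near=> m; rewrite /ball/=.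
  have := cfrac_approx R a0 (_ : n <= m)%N; rewrite -/(c m).
  move=> /(_ ltac:(by near: m; exists n)) h.
  rewrite distrC -(ltr_pM2l (q0 n)) -{1}(gtr0_norm (q0 n)) -normrM.
  rewrite mulrBr [_ * (_ / _)]mulrC divfK ?gt_eqF//.
  apply: le_lt_trans h _; apply: le_lt_trans (_ : _ <= n.+1%:R^-1) _.
    rewrite lef_pV2 ?posrE -?natrM ?ltr0n ?muln_gt0 ?a0 ?cden_gt0// ler_nat.
    by have := cden_ge n a0 a1; have := a0 n; nia.
  by apply: lt_le_trans ne _; rewrite ler_peMl ?(ltW e0)// ler1n cden_gt0.
exists (limn c); first by split.
move=> n; have hc : (fun m => `|(cden a n)%:R * c m - (cnum a n)%:R|) @ \oo -->
    `|(cden a n)%:R * limn c - (cnum a n)%:R|.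
  by apply: cvg_norm; apply: cvgB; [exact: cvgMr|exact: cvg_cst].
apply: (cvgr_to_le hc); near=> m; apply: cfrac_approx => //.
by near: m; exists n.
Unshelve. all: by end_near. Qed.

(** If alpha has denominator d, the integer d (q_n alpha - p_n) has absolute value
    below 1 for all large n, hence vanishes; two consecutive convergents would
    then coincide, against the determinant identity. *)
Lemma irrational_cfrac (R : realType) a (alpha : R) :
  (forall i, 0 < a i.+1)%N -> (1 < a 1)%N ->
  (forall n, `|(cden a n)%:R * alpha - (cnum a n)%:R|
             <= ((a n.+1)%:R * (cden a n)%:R)^-1) ->
  irrational alpha.
Proof.
move=> a0 a1 ha; rewrite irrationalE => r _ /= [_ -> rE].
have d0 : 0 < (denq r)%:~R :> R by rewrite ltr0z denq_gt0.
have key n : (`|denq r| <= n)%N ->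
    (cden a n)%:R * alpha - (cnum a n)%:R = 0 :> R.
  move=> dn; set E := LHS.
  have EZ : E * (denq r)%:~R =
      ((cden a n)%:Z * numq r - (cnum a n)%:Z * denq r)%:~R.
    rewrite /E -rE /ratr rmorphB !rmorphM/= -!pmulrn mulrBl -mulrA divfK//.
    by rewrite gt_eqF.
  have : `|E * (denq r)%:~R| < 1.
    rewrite normrM (gtr0_norm d0) (le_lt_trans (ler_wpM2r (ltW d0) (ha n)))//.
    rewrite mulrC ltr_pdivrMr ?mulr_gt0 ?ltr0n ?cden_gt0// mul1r.
    rewrite -[denq r]gez0_abs ?denq_ge0// -pmulrn -natrM ltr_nat.
    by have := cden_ge n a0 a1; have := a0 n; nia.
  rewrite EZ -intr_norm -[1]/(1%:~R) ltr_int.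
  move=> lt1; have z0 : ((cden a n)%:Z * numq r - (cnum a n)%:Z * denq r) = 0.
    by move: lt1; lia.
  by move: EZ; rewrite z0 => /eqP; rewrite mulf_eq0 (gt_eqF d0) orbF => /eqP.
(* Any two consecutive indices from the denominator of alpha on would do. *)
set n := `|denq r|%N.
have k1 := key n (leqnn _); have k2 := key n.+1 (leqnSn _).
have := continuant_det R a n.+1.
have -> : cnum_prev a n.+1 = cnum a n by [].
have -> : cden_prev a n.+1 = cden a n by [].
move/subr0_eq: k1 => <-; move/subr0_eq: k2 => <-.
rewrite [X in X = _](_ : _ = 0); last by ring.
by move=> /esym/eqP; rewrite signr_eq0.
Qed.

(** * The partial quotients *)

(** Even terms make the parity of the denominators alternate. The double
    exponential leaves room for the factor 16^(q K) in [divergent_of_approx], q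
    being bounded by the square of the previous term. *)
Definition tower (n : nat) : nat := iter n (fun x => 2 ^ (2 ^ x))%N 0%N.

Lemma towerS n : tower n.+1 = (2 ^ 2 ^ tower n)%N.
Proof. by []. Qed.

Lemma tower_even n : ~~ odd (tower n).
Proof. by case: n => // n; rewrite towerS oddX expn_eq0. Qed.

Lemma tower_gt0 n : (0 < tower n.+1)%N.
Proof. by rewrite towerS expn_gt0. Qed.

Lemma odd_cden_even a n : (forall i, ~~ odd (a i)) -> odd (cden a n.*2).
Proof.
move=> ae; rewrite /cden; suff [] : odd (continuants a 1 0 n.*2).1 /\
  ~~ odd (continuants a 1 0 n.*2).2 by [].
elim: n => // n [ih1 ih2]; rewrite doubleS/= !oddD !oddM.
by rewrite !(negbTE (ae _)) (negbTE ih2) ih1.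
Qed.

Lemma tower_growth n : (n.+2 <= tower n.+2 /\ 16 <= tower n.+2)%N.
Proof.
elim: n => // n [ih1 ih2]; rewrite towerS.
have h : (tower n.+2 < 2 ^ 2 ^ tower n.+2)%N.
  by apply: ltn_trans (ltn_expl _ _) (ltn_expl _ _).
by split; [apply: leq_ltn_trans h|apply/ltnW/(leq_ltn_trans _ h)].
Qed.

Lemma cube_le_exp2 x : (16 <= x)%N -> (8 * x ^ 3 <= 2 ^ x)%N.
Proof.
move=> x16; rewrite -(subnK x16); elim: (x - 16)%N => [|k ih].
  have -> : (8 * 16 ^ 3 = 2 ^ (3 + 4 * 3))%N by rewrite expnD expnM.
  by rewrite add0n leq_exp2l.
rewrite addSn [leqRHS]expnS; apply: leq_trans (leq_mul (leqnn 2) ih).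
by move: (k + 16)%N (leq_addl k 16) => y y16; rewrite !expnS expn0; nia.
Qed.

Lemma sqr_lt_exp2_exp2 x : (x ^ 2 < 2 ^ 2 ^ x)%N.
Proof.
have h : (x < 2 ^ x.-1.+1)%N by case: x => // x; exact: ltn_expl.
apply: leq_ltn_trans (_ : _ <= (2 ^ x.-1) ^ 2)%N _.
  by rewrite leq_sqr; case: x h => // x _; exact: ltn_expl.
rewrite -expnM ltn_exp2l//; case: x h => // x _ /=; rewrite expnS mulnC.
by rewrite ltn_pmul2l// ltn_expl.
Qed.

(** The denominator q_(n+1) is at most (a_(n+1) + 1) q_n, and q_n is already
    smaller than a_(n+1), because a_n^2 is. *)
Lemma cden_tower n : (cden tower n.+1 < tower n.+1 ^ 2)%N.
Proof.
suff [] : (cden tower n.+1 < tower n.+1 ^ 2)%N /\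
  (cden_prev tower n.+1 <= cden tower n.+1)%N by [].
elim: n => // n [ih1 ih2].
have := ltn_trans ih1 (sqr_lt_exp2_exp2 _).
rewrite -towerS.
have -> : cden tower n.+2 =
  (tower n.+2 * cden tower n.+1 + cden_prev tower n.+1)%N by [].
have -> : cden_prev tower n.+2 = cden tower n.+1 by [].
have := tower_gt0 n.+1; move: (tower n.+2) => A; rewrite expnS expn1; nia.
Qed.

(** With x = a_(n+2), the denominator q is below x^2 and K is at most x, so the
    left-hand side divided by q is at most 2 to a power cubic in x, while
    the right-hand side divided by q is 2^(2^x). *)
Lemma tower_dominates K n : (K <= n.+2)%N ->
  (2 * cden tower n.+2 ^ 2 * 16 ^ (cden tower n.+2 * K) + cden tower n.+2
   < tower n.+3 * cden tower n.+2)%N.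
Proof.
move=> Kn; set q := cden tower n.+2; have [nx x16] := tower_growth n.
have qx := cden_tower n.+1.
have q0 : (0 < q)%N by apply: cden_gt0 tower_gt0.
have -> : (2 * q ^ 2 * 16 ^ (q * K) + q = (2 * q * 16 ^ (q * K) + 1) * q)%N by ring.
rewrite ltn_pmul2r//; apply: leq_trans (_ : _ <= 2 ^ (q.+1 + 4 * (q * K)))%N _.
  have qq := ltn_expl q (ltnSn 1); have e0 : (0 < 16 ^ (q * K))%N by rewrite expn_gt0.
  by rewrite expnD (expnM 2 4) (_ : 2 ^ 4 = 16)%N// (expnS 2 q); nia.
rewrite towerS leq_exp2l//.
apply: leq_trans (cube_le_exp2 x16).
move: (tower n.+2) nx x16 qx => x nx x16; rewrite -/q => qx.
have : (q * K <= x ^ 2 * x)%N by apply: leq_mul; lia.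
by rewrite -expnSr; have : (x ^ 2 <= x ^ 3)%N by [rewrite leq_exp2l//; lia]; nia.
Qed.

(** * Computability of the partial quotients *)

Lemma recursive_ext n (f g : n.-tuple nat -> nat) :
  f =1 g -> recursive f -> recursive g.
Proof. by move=> /funext ->. Qed.

Lemma recursive_add :
  recursive (fun v : 2.-tuple nat => tnth v ord0 + tnth v ord_max)%N.
Proof.
have hS := recursive_comp (g := fun _ => _) recursive_succ
  (fun _ : 'I_1 => recursive_proj (lift ord0 ord0 : 'I_3)).
apply: recursive_ext (recursive_prec (recursive_proj (ord0 : 'I_1)) hS) => v.
case/tupleP: v => x v; case/tupleP: v => y v; rewrite [v]tuple0 /= !theadE.
rewrite (tnth_nth 0%N) /= [RHS]addnC (tnth_nth 0%N) /=.
elim: x => [|x ih] /=; first by rewrite addn0.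
by rewrite /thead tnth_mktuple (tnth_nth 0%N) /= ih addnS.
Qed.

(** Iteration is primitive recursion whose step ignores the counter. *)
Lemma computable_iter (g : nat -> nat) (c : nat) :
  computable g -> recursive (fun _ : 0.-tuple nat => c) ->
  computable (fun n => iter n g c).
Proof.
move=> hg hc.
have hG := recursive_comp (g := fun _ => _) hg
  (fun _ : 'I_1 => recursive_proj (lift ord0 ord0 : 'I_2)).
apply: recursive_ext (recursive_prec hc hG) => v /=.
elim: (thead v) => //= k ->; rewrite /thead tnth_mktuple (tnth_nth 0%N) //=.
Qed.

Lemma computable_comp (f g : nat -> nat) :
  computable f -> computable g -> computable (f \o g).
Proof.
move=> hf hg; apply: recursive_ext (recursive_comp (g := fun _ => _) hf
  (fun _ : 'I_1 => hg)) => v /=.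
by rewrite /thead tnth_mktuple.
Qed.

Lemma computable_double : computable double.
Proof.
apply: recursive_ext (recursive_comp (g := fun _ => _) recursive_add
  (fun _ : 'I_2 => recursive_proj (ord0 : 'I_1))) => v /=.
by rewrite !tnth_mktuple addnn.
Qed.

Lemma computable_exp2 : computable (fun n => 2 ^ n)%N.
Proof.
have h1 : recursive (fun _ : 0.-tuple nat => 1%N).
  apply: recursive_ext (recursive_comp (g := fun _ => _) recursive_succ
    (fun _ : 'I_1 => recursive_zero)) => v /=.
  by rewrite /thead tnth_mktuple.
have -> : (fun n => 2 ^ n)%N = (fun n => iter n double 1%N).
  by apply: funext; elim=> // n ih; rewrite expnS ih mul2n.
exact: computable_iter computable_double h1.
Qed.

Lemma computable_tower : computable tower.
Proof.
exact: (computable_iter (g := (fun x => 2 ^ x)%N \o (fun x => 2 ^ x)%N)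
  (computable_comp computable_exp2 computable_exp2) recursive_zero).
Qed.

(** * The divergent rotation number *)

Unset Implicit Arguments.

Theorem theorem1 (R : realType) (U : set (circle R))
    (hU : finite_disjoint_union_of_arcs U)
    (hm : circle_measure U = (2^-1)%:E) :
  exists (alpha : R) (a : nat -> nat),
    [/\ irrational alpha,
        0 < alpha < 1,
        forall x : circle R,
          divergent_for (fun n : nat => n%:R^-1 : R)
            (fun y : circle R => 2 * \1_U y - 1) alpha x,
        has_cfrac_expansion alpha a
      & computable a].
Proof.
have t1 : (1 < tower 1)%N by [].
have [alpha hexp happ] := cfrac_limit R tower_gt0 t1.
have irr := irrational_cfrac tower_gt0 t1 happ.
exists alpha, tower; split=> //; last exact: computable_tower.
- have alpha0 : 0 <= alpha.
    apply: (cvgr_to_ge hexp.2); near=> n.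
    by rewrite -cfrac_tail0; exact: cfrac_tail_ge0.
  have alphaN0 : alpha != 0.
    apply/eqP => alphaE; apply: irr; apply/rationalP.
    by exists 0, 1%N; rewrite alphaE mul0r.
  rewrite lt0r alphaN0 alpha0/=.
  (* The zeroth convergent is 0/1, so it bounds alpha by 1/a_1. *)
  have := happ 0%N; rewrite mul1r subr0 mulr1 ger0_norm// => h.
  by apply: le_lt_trans h _; rewrite invf_lt1// ltr1n.
- move=> x; have [E hE] := crossed_at_union hU.
  apply: (divergent_of_approx hE irr) => K n0.
  set n := (K + n0).*2; have q0 := cden_gt0 n.+2 tower_gt0.
  exists (cden tower n.+2), (cnum tower n.+2)%:Z; split.
  + by rewrite -[n.+2]/((K + n0).+1.*2); apply: odd_cden_even tower_even.
  + by have := cden_ge n.+2 tower_gt0 t1; rewrite /n; lia.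
  + rewrite -pmulrn; apply: le_lt_trans (ler_wpM2r _ (happ n.+2)) _ => //.
    rewrite mulrC ltr_pdivrMr ?mulr_gt0 ?ltr0n ?tower_gt0// mul1r -natrM ltr_nat.
    by apply: tower_dominates; rewrite /n; lia.
Unshelve. all: by end_near. Qed.
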